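(* Let $\sigma=\sigma^\infty$, with $\sigma^\infty$ the asymptotic restriction defined in the context. Assume that the restricted problem $\mathrm{LP}(\sigma^\infty)$ is feasible and that its optimal solution is unique. Assume moreover that Slater's condition holds for $\sigma=\sigma^\infty$ with $\sigma^\infty>0$: there exists $(\hat z_1,\ldots,\hat z_N)$ with $\hat z_i\in\mathrm{conv}(X_i)$ for all $i$ such that $$\zeta:=\min_{s\in\{1,\ldots,S\}}\Big[b-\sigma^\infty-\sum_{i=1}^N A_i\hat z_i\Big]_s>0.$$ Let $(y_1^\star,\ldots,y_N^\star)$ be an optimal solution of the master problem $\mathrm{Master}(\sigma^\infty)$ and let each $x_i^\infty$ be an optimal solution of the lexicographic problem $\mathrm{Lex}_i(y_i^\star)$. Then $(x_1^\infty,\ldots,x_N^\infty)$ satisfies $$\sum_{i=1}^N c_i^\top x_i^\infty-J^{\mathrm{MILP}}\le B,\qquad B:=\Big(S+\frac{N\|\sigma^\infty\|_\infty}{\zeta}\Big)\max_{i\in\{1,\ldots,N\}}\gamma_i,$$ where $J^{\mathrm{MILP}}$ is the optimal cost of the target MILP and $\gamma_i:=\max_{x_i\in X_i}c_i^\top x_i-\min_{x_i\in X_i}c_i^\top x_i$.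
   Context: Setting. There are $N$ agents and $S$ linear coupling constraints (the regime of interest is $N\gg S$; no quantitative relation is imposed). For each $i\in\{1,\ldots,N\}$: $X_i=P_i\cap(\mathbb{Z}^{p_i}\times\mathbb{R}^{q_i})$ with $P_i\subset\mathbb{R}^{p_i+q_i}$ a nonempty compact polyhedron, $c_i\in\mathbb{R}^{p_i+q_i}$, $A_i\in\mathbb{R}^{S\times(p_i+q_i)}$; and $b\in\mathbb{R}^S$. The target MILP is: minimize $\sum_{i=1}^N c_i^\top x_i$ subject to $\sum_{i=1}^N A_ix_i\le b$ and $x_i\in X_i$ for all $i$; it is assumed feasible. Vector inequalities are componentwise, $\max$ and $\min$ of vectors are componentwise, $[\cdot]_s$ is the $s$-th component, $\mathbf{1}$ is the vector of ones, and $\mathrm{conv}(X_i)$ is the convex hull of $X_i$. Restricted problem $\mathrm{LP}(\sigma)$, for $\sigma\in\mathbb{R}^S$, $\sigma\ge0$: minimize $\sum_{i=1}^N c_i^\top z_i$ over $z_1,\dots,z_N$ subject to $\sum_{i=1}^N A_iz_i\le b-\sigma$ and $z_i\in\mathrm{conv}(X_i)$ for all $i$. Master problem $\mathrm{Master}(\sigma)$: minimize $\sum_{i=1}^N \pi_i(y_i)$ over $y_1,\dots,y_N\in\mathbb{R}^S$ subject to $\sum_{i=1}^N y_i=b-\sigma$ and $y_i\in Y_i$ for all $i$, where $\pi_i(y_i)=\min\{c_i^\top z_i : A_iz_i\le y_i,\ z_i\in\mathrm{conv}(X_i)\}$ and $Y_i$ is the set of $y_i\in\mathbb{R}^S$ for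 which this minimization is feasible. Lexicographic problem $\mathrm{Lex}_i(y_i)$: minimize lexicographically $\rho_i$, then $\xi_i$, over $(\rho_i,\xi_i,x_i)$ subject to $c_i^\top x_i\le\xi_i$, $A_ix_i\le y_i+\rho_i\mathbf{1}$, $x_i\in X_i$, $\rho_i\ge0$. Equivalently: first let $\bar\rho_i$ be the minimum of $\rho_i\ge 0$ such that some $x_i\in X_i$ satisfies $A_ix_i\le y_i+\rho_i\mathbf{1}$; then $x_i$ is a minimizer of $c_i^\top x_i$ over $x_i\in X_i$ with $A_ix_i\le y_i+\bar\rho_i\mathbf{1}$. Asymptotic restriction: let $L_i=\min_{x_i\in X_i}A_ix_i\in\mathbb{R}^S$ (componentwise), $\rho_i^{\max}=\min_{x_i\in X_i}\max_{s\in\{1,\ldots,S\}}[A_ix_i-L_i]_s$, $\sigma_i^{\mathrm{loc}}=\min\{\rho_i^{\max}\mathbf{1},\ \max_{x_i\in X_i}(A_ix_i-L_i)\}\in\mathbb{R}^S$ (componentwise), and $\sigma^\infty=S\cdot\max_{i\in\{1,\ldots,N\}}\sigma_i^{\mathrm{loc}}\in\mathbb{R}^S$ (componentwise). *)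

(* Defs.v *)
From HB Require Import structures.
From mathcomp Require Import all_boot all_order all_algebra.
From mathcomp Require Import all_classical all_reals all_analysis.

Set Implicit Arguments.
Unset Strict Implicit.
Unset Printing Implicit Defensive.

Import Order.TTheory GRing.Theory Num.Theory.
Import numFieldNormedType.Exports.

Local Open Scope classical_set_scope.
Local Open Scope ring_scope.

Section Optimization.
Variables (R : realType) (T : Type).
Implicit Types (D : set T) (f : T -> R).

(* [inf] and [sup] are total and are 0 on an empty (or unbounded) set. Every use
   below is over a nonempty finite or compact set with a continuous objective,
   where they are the attained minimum and maximum, or over the feasible set of
   a feasible problem whose minimum is attained. *)
Definition min_over D f : R := inf [set f x | x in D].
Definition max_over D f : R := sup [set f x | x in D].

Definition minimizer D f (x : T) : Prop :=
  D x /\ forall x', D x' -> f x <= f x'.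

End Optimization.

Section Vectors.
Variable R : realType.

Definition vle m (u v : 'cV[R]_m) : Prop := forall s, u s 0 <= v s 0.

Definition cost m (c x : 'cV[R]_m) : R := (c^T *m x) 0 0.

Definition polyhedron m (P : set 'cV[R]_m) : Prop :=
  exists k (G : 'M[R]_(k, m)) (h : 'cV[R]_k), P = [set x | vle (G *m x) h].

Definition mixed_integer p q : set 'cV[R]_(p + q) :=
  [set x | forall k : 'I_p, x (lshift q k) 0 \is a Num.int].

Definition conv_hull m (X : set 'cV[R]_m) : set 'cV[R]_m :=
  [set z | exists k (w : 'I_k -> R) (v : 'I_k -> 'cV[R]_m),
    [/\ forall j, 0 <= w j, \sum_j w j = 1, forall j, X (v j)
      & z = \sum_j w j *: v j]].

End Vectors.

Arguments mixed_integer R p q : clear implicits.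

Section Agent.
Variables (R : realType) (S n : nat).
Variables (X : set 'cV[R]_n) (c : 'cV[R]_n) (A : 'M[R]_(S, n)).

Definition agent_feasible (y : 'cV[R]_S) : set 'cV[R]_n :=
  [set z | vle (A *m z) y /\ conv_hull X z].

Definition agent_value (y : 'cV[R]_S) : R :=
  min_over (agent_feasible y) (cost c).

Definition agent_domain : set 'cV[R]_S := [set y | agent_feasible y !=set0].

Definition lex_feasible (y : 'cV[R]_S) (rho xi : R) (x : 'cV[R]_n) : Prop :=
  [/\ cost c x <= xi, vle (A *m x) (y + const_mx rho), X x & 0 <= rho].

Definition lex_optimal (y : 'cV[R]_S) (rho xi : R) (x : 'cV[R]_n) : Prop :=
  lex_feasible y rho xi x /\
  forall rho' xi' x', lex_feasible y rho' xi' x' ->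
    rho < rho' \/ (rho = rho' /\ xi <= xi').

Definition min_usage : 'cV[R]_S :=
  \col_s min_over X (fun x => (A *m x) s 0).

Definition rho_max : R :=
  min_over X (fun x =>
    max_over [set: 'I_S] (fun s => (A *m x - min_usage) s 0)).

Definition sigma_loc : 'cV[R]_S :=
  \col_s Num.min rho_max (max_over X (fun x => (A *m x - min_usage) s 0)).

Definition cost_range : R := max_over X (cost c) - min_over X (cost c).

End Agent.

Section Coupled.
Variables (R : realType) (N S : nat) (n : 'I_N -> nat).
Variables (X : forall i, set 'cV[R]_(n i)) (c : forall i, 'cV[R]_(n i)).
Variables (A : forall i, 'M[R]_(S, n i)) (b : 'cV[R]_S).
Arguments X : clear implicits.

Definition total_cost (x : forall i, 'cV[R]_(n i)) : R :=
  \sum_i cost (c i) (x i).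

Definition milp_feasible : set (forall i, 'cV[R]_(n i)) :=
  [set x | vle (\sum_i A i *m x i) b /\ forall i, X i (x i)].

Definition milp_value : R := min_over milp_feasible total_cost.

Definition lp_feasible (sigma : 'cV[R]_S) : set (forall i, 'cV[R]_(n i)) :=
  [set z | vle (\sum_i A i *m z i) (b - sigma) /\
           forall i, conv_hull (X i) (z i)].

Definition lp_optimal (sigma : 'cV[R]_S) (z : forall i, 'cV[R]_(n i)) : Prop :=
  minimizer (lp_feasible sigma) total_cost z.

Definition master_feasible (sigma : 'cV[R]_S) : set ('I_N -> 'cV[R]_S) :=
  [set y | \sum_i y i = b - sigma /\
           forall i, agent_domain (X i) (A i) (y i)].

Definition master_cost (y : 'I_N -> 'cV[R]_S) : R :=
  \sum_i agent_value (X i) (c i) (A i) (y i).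

Definition master_optimal (sigma : 'cV[R]_S) (y : 'I_N -> 'cV[R]_S) : Prop :=
  minimizer (master_feasible sigma) master_cost y.

Definition sigma_infty : 'cV[R]_S :=
  S%:R *: \col_s max_over [set: 'I_N] (fun i => sigma_loc (X i) (A i) s 0).

Definition slater_margin (sigma : 'cV[R]_S)
    (zhat : forall i, 'cV[R]_(n i)) : R :=
  min_over [set: 'I_S]
    (fun s => (b - sigma - \sum_i A i *m zhat i) s 0).

Definition max_cost_range : R :=
  max_over [set: 'I_N] (fun i => cost_range (X i) (c i)).

End Coupled.

(* Main.v *)
Require Import Defs.
From HB Require Import structures.
From mathcomp Require Import all_boot all_order all_algebra.
From mathcomp Require Import all_classical all_reals all_analysis.
From mathcomp Require Import ring lra.

Set Implicit Arguments.
Unset Strict Implicit.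
Unset Printing Implicit Defensive.

Import Order.TTheory GRing.Theory Num.Theory.
Import numFieldNormedType.Exports.

Local Open Scope classical_set_scope.
Local Open Scope ring_scope.

(** The bound splits into two costs, compared through an optimal solution [z] of
the restricted problem LP(sigma).

An optimal resource allocation [ystar] of the master problem yields such a [z]:
let [z i] attain the value of agent [i] at [ystar i]. The master problem is at
most as expensive as the restricted one, since from any LP-feasible point one
may allocate to each agent what it uses and give the slack to one of them
([master_lp_optimal]). Attainment needs the convex hull of a compact set to be
compact; by Caratheodory's theorem that hull is reached by joining points of
the set finitely many times ([conv_hull_compact]).

At most [S] of the points [z i] lie outside [X i]. Each such [z i] can be moved
both ways along some segment of the hull, and more than [S] such directions
have a nontrivial combination along which the [S] coupling constraints do not
change; moving along it either lowers the cost or gives a second optimal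
solution, against uniqueness ([lp_unique_integral]). If [z i] is in [X i], the
lexicographic problem has violation zero and its solution is no costlier than
[z i]; each of the other agents loses at most its cost range. Hence the
recovered solution costs at most [S] times the largest cost range more than
[z].

Finally [z] is compared with an arbitrary MILP-feasible [x]: moving from [x]
towards the Slater point by the fraction |sigma| / (|sigma| + zeta) gains enough
room to satisfy the restricted constraints, at the price of at most that
fraction of every agent's cost range ([lp_slater_cost]). *)

(** * Linear dependence *)

(** The coefficients are carried by the whole index type, zero outside [D], so
that sums over agents need no reindexing. *)
Lemma linear_dependence (F : fieldType) (I : finType) (D : {set I}) m
    (a : I -> 'cV[F]_m) : (m < #|D|)%N ->
  exists l : I -> F, [/\ exists i, l i != 0,
    forall i, i \notin D -> l i = 0 & \sum_i l i *: a i = 0].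
Proof.
move=> ltmD; pose M := \matrix_(j < #|D|) (a (enum_val j))^T.
have /rowV0Pn[u /sub_kermxP uM u0] : kermx M != 0.
  by rewrite kermx_eq0 /row_free neq_ltn (leq_ltn_trans (rank_leq_col M)).
pose l i := \sum_(j | enum_val j == i) u 0 j.
exists l; split.
- have /rV0Pn[j uj] : u != 0 by [].
  exists (enum_val j); rewrite /l (big_pred1 j) // => j' /=.
  by rewrite (inj_eq enum_val_inj).
- move=> i iD; rewrite /l big_pred0 // => j; apply: contraNF iD => /eqP <-.
  exact: enum_valP.
- under eq_bigr do rewrite scaler_suml.
  rewrite (exchange_big_dep xpredT) //=.
  apply: trmx_inj; rewrite trmx0 -uM mulmx_sum_row linear_sum /=.
  apply: eq_bigr => j _; rewrite (big_pred1 (enum_val j)).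
    by rewrite linearZ /= rowK.
  by move=> i /=; rewrite eq_sym.
Qed.

(** * Convex hulls of compact sets *)

Section ConvexHull.
Variables (R : realType) (m : nat).
Implicit Types (X : set 'cV[R]_m) (x y z : 'cV[R]_m) (t : R).

Lemma subset_conv_hull X : X `<=` conv_hull X.
Proof.
move=> x Xx; exists 1%N, (fun=> 1), (fun=> x).
by rewrite !big_ord1 scale1r.
Qed.

Lemma conv_hull_convex X x y t : 0 <= t <= 1 ->
  conv_hull X x -> conv_hull X y -> conv_hull X ((1 - t) *: x + t *: y).
Proof.
move=> /andP[t0 t1] [k1 [w1 [v1 [w1_ge0 w1_sum Xv1 ->]]]].
move=> [k2 [w2 [v2 [w2_ge0 w2_sum Xv2 ->]]]].
pose w (j : 'I_(k1 + k2)) := match fintype.split j with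
  inl i => (1 - t) * w1 i | inr i => t * w2 i end.
pose v (j : 'I_(k1 + k2)) := match fintype.split j with
  inl i => v1 i | inr i => v2 i end.
have wl i : w (lshift k2 i) = (1 - t) * w1 i by rewrite /w (unsplitK (inl i)).
have wr i : w (rshift k1 i) = t * w2 i by rewrite /w (unsplitK (inr i)).
have vl i : v (lshift k2 i) = v1 i by rewrite /v (unsplitK (inl i)).
have vr i : v (rshift k1 i) = v2 i by rewrite /v (unsplitK (inr i)).
exists (k1 + k2)%N, w, v; split.
- by move=> j; rewrite /w; case: fintype.split => i;
    rewrite mulr_ge0 // subr_ge0.
- rewrite big_split_ord /= (eq_bigr _ (fun i _ => wl i)).
  rewrite (eq_bigr _ (fun i _ => wr i)) -!mulr_sumr w1_sum w2_sum !mulr1.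
  exact: subrK.
- by move=> j; rewrite /v; case: fintype.split.
- rewrite big_split_ord /= !scaler_sumr; congr (_ + _); apply: eq_bigr => i _.
    by rewrite wl vl scalerA.
  by rewrite wr vr scalerA.
Qed.

Lemma conv_hull_mulmx_le k (A : 'M[R]_(k, m)) s (u : R) X :
  (forall x, X x -> (A *m x) s 0 <= u) ->
  forall z, conv_hull X z -> (A *m z) s 0 <= u.
Proof.
move=> Xu _ [l [w [v [w_ge0 w_sum Xv ->]]]].
rewrite mulmx_sumr summxE -[u]mul1r -w_sum mulr_suml; apply: ler_sum => j _.
by rewrite -scalemxAr mxE ler_wpM2l ?Xu.
Qed.

(** The join of [K] and [X], the union of all segments from [K] to [X], written
as a continuous image of [[0, 1] * K * X] because its compactness is then
immediate. *)
Definition hull_step (K X : set 'cV[R]_m) : set 'cV[R]_m :=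
  (fun u : R * ('cV[R]_m * 'cV[R]_m) => (1 - u.1) *: u.2.1 + u.1 *: u.2.2) @`
    (`[0, 1]%classic `*` (K `*` X)).

Definition iter_hull X k := iter k (fun K => hull_step K X) X.

Lemma hull_stepP (K X : set 'cV[R]_m) t x y : 0 <= t <= 1 -> K x -> X y ->
  hull_step K X ((1 - t) *: x + t *: y).
Proof.
by move=> t01 Kx Xy; exists (t, (x, y)); split => //=; rewrite in_itv.
Qed.

Lemma iter_hull_compact X k : compact X -> compact (iter_hull X k).
Proof.
move=> cX; elim: k => //= k IH; apply: continuous_compact.
  apply: continuous_subspaceT => -[t [x y]].
  apply: cvgD; apply: cvgZ.
  - apply: cvgB; first exact: cvg_cst.
    exact: cvg_fst.
  - exact: cvg_comp cvg_snd cvg_fst.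
  - exact: cvg_fst.
  - exact: cvg_comp cvg_snd cvg_snd.
apply: compact_setX; first exact: segment_compact.
exact: compact_setX.
Qed.

Lemma iter_hullS X k : X !=set0 -> iter_hull X k `<=` iter_hull X k.+1.
Proof.
move=> [x0 Xx0] x Kx.
have -> : x = (1 - 0) *: x + 0 *: x0 by rewrite subr0 scale1r scale0r addr0.
by apply: hull_stepP => //; rewrite lexx ler01.
Qed.

Lemma iter_hull_le X k l : X !=set0 -> (k <= l)%N ->
  iter_hull X k `<=` iter_hull X l.
Proof.
move=> X0 /subnKC <-; elim: (l - k)%N => [|d IH]; rewrite ?addn0 // addnS.
by move=> x /IH; exact: iter_hullS.
Qed.

(** The last point of a combination is split off: unless its weight is 1, the
remaining weights can be renormalised and the combination lies on a segment
ending at that point. *)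
Lemma iter_hull_comb X k (w : 'I_k.+1 -> R) (v : 'I_k.+1 -> 'cV[R]_m) :
  (forall j, 0 <= w j) -> \sum_j w j = 1 -> (forall j, X (v j)) ->
  iter_hull X k (\sum_j w j *: v j).
Proof.
elim: k w v => [|k IH] w v w_ge0 w_sum Xv.
  by move: w_sum; rewrite !big_ord1 => ->; rewrite scale1r; exact: Xv.
rewrite big_ord_recr /=; move: w_sum; rewrite big_ord_recr /=.
set t := w ord_max => w_sum.
have s_ge0 : 0 <= \sum_(i < k.+1) w (widen_ord (leqnSn k.+1) i).
  exact: sumr_ge0.
have sE : \sum_(i < k.+1) w (widen_ord (leqnSn k.+1) i) = 1 - t.
  by rewrite -w_sum addrK.
have [t1|t1] := eqVneq t 1.
  rewrite big1 => [|i _].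
    rewrite add0r t1 scale1r.
    have X0 : X !=set0 by exists (v ord_max).
    exact: (iter_hull_le X0 (leq0n k.+1) (Xv ord_max)).
  move: sE; rewrite t1 subrr => /eqP.
  rewrite psumr_eq0 // => /allP/(_ i).
  by rewrite mem_index_enum => /(_ isT)/eqP ->; rewrite scale0r.
have t_le1 : t <= 1 by rewrite -subr_ge0 -sE.
have t_lt1 : 0 < 1 - t by rewrite subr_gt0 lt_neqAle t1.
have -> : \sum_(i < k.+1) w (widen_ord (leqnSn k.+1) i) *:
      v (widen_ord (leqnSn k.+1) i) =
    (1 - t) *: \sum_(i < k.+1) (w (widen_ord (leqnSn k.+1) i) / (1 - t)) *:
      v (widen_ord (leqnSn k.+1) i).
  rewrite scaler_sumr; apply: eq_bigr => i _.
  by rewrite scalerA mulrC divfK // gt_eqF.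
apply: hull_stepP => //; first by rewrite w_ge0.
apply: IH => //.
- by move=> j; rewrite divr_ge0 // ltW.
- by rewrite -mulr_suml sE divff // gt_eqF.
Qed.

(** More than [m + 1] points of an [m]-dimensional space are affinely dependent.
Subtracting from the weights the largest admissible multiple of a dependence
makes one of them vanish. *)
Lemma caratheodory_step X k (w : 'I_k.+1 -> R) (v : 'I_k.+1 -> 'cV[R]_m) :
  (m < k)%N ->
  (forall j, 0 <= w j) -> \sum_j w j = 1 -> (forall j, X (v j)) ->
  exists w' : 'I_k -> R, exists v' : 'I_k -> 'cV[R]_m,
    [/\ forall j, 0 <= w' j, \sum_j w' j = 1, forall j, X (v' j)
      & \sum_j w j *: v j = \sum_j w' j *: v' j].
Proof.
move=> ltmk w_ge0 w_sum Xv.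
(* A linear dependence of the points with a coordinate 1 appended is an affine
   dependence of the points. *)
have [|l [[i0 li0] _ l_dep]] :=
    @linear_dependence R 'I_k.+1 [set: 'I_k.+1] _
      (fun j => col_mx (v j) (1 : 'cV[R]_1)).
  by rewrite cardsT card_ord addn1 ltnS.
have lv : \sum_j l j *: v j = 0.
  have := congr1 usubmx l_dep; rewrite linear0 => lu.
  rewrite -[RHS]lu linear_sum; apply: eq_bigr => j _.
  by rewrite linearZ /= col_mxKu.
have l_sum : \sum_j l j = 0.
  have := congr1 dsubmx l_dep; rewrite linear0 => /matrixP/(_ 0 0).
  rewrite [RHS]mxE => ld; rewrite -[RHS]ld linear_sum summxE.
  apply: eq_bigr => j _.
  by rewrite linearZ /= col_mxKd !mxE eqxx mulr1.
have [i1 li1] : exists i, 0 < l i.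
  apply: contrapT => /forallNP l_le0.
  have l_le j : 0 <= - l j by rewrite oppr_ge0 leNgt; exact/negP/l_le0.
  move: l_sum => /eqP; rewrite -oppr_eq0 -sumrN psumr_eq0 // => /allP/(_ i0).
  by rewrite mem_index_enum oppr_eq0 (negPf li0) => /(_ isT).
(* The ratio test: the weight of [j0] is the first to vanish. *)
pose j0 := [arg min_(j < i1 | 0 < l j) (w j / l j)]%O.
have [lj0 j0_min] : 0 < l j0 /\ forall j, 0 < l j -> w j0 / l j0 <= w j / l j.
  by rewrite /j0; case: arg_minP.
pose t := w j0 / l j0.
have t_ge0 : 0 <= t by rewrite divr_ge0 // ltW.
pose w1 j := w j - t * l j.
have w1_j0 : w1 j0 = 0 by rewrite /w1 /t divfK ?subrr // gt_eqF.
have w1_ge0 j : 0 <= w1 j.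
  rewrite subr_ge0; have [lj|lj] := ltP 0 (l j).
    by rewrite -ler_pdivlMr // j0_min.
  by rewrite (le_trans _ (w_ge0 j)) // mulr_ge0_le0.
exists (fun j => w1 (lift j0 j)), (fun j => v (lift j0 j)); split => //.
- have := @bigD1_ord R +%R 0 _ j0 predT w1 isT; rewrite /= w1_j0 add0r => <-.
  by rewrite sumrB -mulr_sumr l_sum mulr0 subr0.
- have := @bigD1_ord _ +%R 0 _ j0 predT (fun j => w1 j *: v j) isT.
  rewrite /= w1_j0 scale0r add0r => <-.
  under [RHS]eq_bigr do rewrite scalerBl -scalerA.
  by rewrite sumrB -scaler_sumr lv scaler0 subr0.
Qed.

Lemma conv_hull_iter X : conv_hull X `<=` iter_hull X m.
Proof.
move=> _ [k [w [v [w_ge0 w_sum Xv ->]]]].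
elim: k w v w_ge0 w_sum Xv => [|k IH] w v w_ge0 w_sum Xv.
  by move: w_sum; rewrite big_ord0 => /eqP; rewrite eq_sym oner_eq0.
have [lekm|ltmk] := leqP k m.
  apply: iter_hull_le lekm _ _; first by exists (v ord0).
  exact: iter_hull_comb.
have [w' [v' [w'_ge0 w'_sum Xv' ->]]] :=
  caratheodory_step ltmk w_ge0 w_sum Xv.
exact: IH.
Qed.

Lemma iter_hull_conv X k : iter_hull X k `<=` conv_hull X.
Proof.
elim: k => [|k IH] /=; first exact: subset_conv_hull.
move=> _ [[t [x y]] [/= t01 [/IH hx Xy]] <-].
apply: conv_hull_convex => //.
exact: subset_conv_hull.
Qed.

(** By Caratheodory's theorem the hull is the [m]-th iterated join, a compact
set. *)
Lemma conv_hull_compact X : compact X -> compact (conv_hull X).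
Proof.
move=> cX; suff -> : conv_hull X = iter_hull X m by exact: iter_hull_compact.
by apply/seteqP; split; [exact: conv_hull_iter|exact: iter_hull_conv].
Qed.

End ConvexHull.

(** * Closedness, continuity and extrema *)

Lemma continuous_mulmx_entry (R : realType) k m (A : 'M[R]_(k, m)) (s : 'I_k) :
  continuous (fun x : 'cV[R]_m => (A *m x) s 0).
Proof.
rewrite (_ : (fun x => _) = (fun x : 'cV[R]_m => \sum_j A s j * x j 0)).
  apply: continuous_big => [|j _ x]; first exact: add_continuous.
  apply: (@continuous_comp _ _ _ (fun y : 'cV[R]_m => y j 0) ( *%R (A s j))).
    exact: coord_continuous.
  exact: mulrl_continuous.
by apply/funext => x; rewrite mxE.
Qed.

(** A real that is not an integer lies in the open interval between its floor
and the next integer, which contains no integer. *)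
Lemma closed_int (R : realType) : closed [set x : R | x \is a Num.int].
Proof.
rewrite -[X in closed X]setCK; apply: open_closedC; rewrite openE => x /= xNint.
have xI : x \in `](Num.floor x)%:~R, (Num.floor x + 1)%:~R[.
  rewrite in_itv /= floorD1_gt andbT lt_neqAle floor_le andbT.
  by apply/negP => xE; apply: xNint; rewrite intrEfloor.
near=> y => /= /intrP[k yk].
have : y \in `](Num.floor x)%:~R, (Num.floor x + 1)%:~R[.
  by near: y; exact: near_in_itvoo.
by rewrite in_itv /= yk !ltr_int ltzD1; case: ltP.
Unshelve. all: by end_near. Qed.

Lemma mixed_integer_closed (R : realType) p q : closed (mixed_integer R p q).
Proof.
rewrite (_ : mixed_integer R p q =
  \bigcap_(k in [set: 'I_p])
    (fun x : 'cV[R]_(p + q) => x (lshift q k) 0) @^-1`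
      [set t : R | t \is a Num.int]).
  apply: closed_bigI => k _; apply: preimage_closed => [x _|].
    exact: coord_continuous.
  exact: closed_int.
by apply/seteqP; split => x /= xi => [k _|k]; exact: xi.
Qed.

Section Extrema.
Variables (R : realType) (T : Type).
Implicit Types (D : set T) (f : T -> R).

Lemma min_over_minimizer D f x : minimizer D f x -> min_over D f = f x.
Proof.
move=> [Dx fx]; apply/eqP; rewrite eq_le; apply/andP; split.
  apply: ge_inf; last by exists x.
  by exists (f x) => _ [y Dy <-]; exact: fx.
by apply: lb_le_inf; [exists (f x), x | move=> _ [y Dy <-]; exact: fx].
Qed.

Lemma max_over_ge D f x :
  has_ubound [set f y | y in D] -> D x -> f x <= max_over D f.
Proof. by move=> ub Dx; apply: ub_le_sup => //; exists x. Qed.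

Lemma min_over_le D f x :
  has_lbound [set f y | y in D] -> D x -> min_over D f <= f x.
Proof. by move=> lb Dx; apply: ge_inf => //; exists x. Qed.

End Extrema.

Lemma max_over_fin_ge (R : realType) (I : finType) (f : I -> R) i :
  f i <= max_over [set: I] f.
Proof.
apply: max_over_ge => //; exists (\sum_j `|f j|) => _ [j _ <-].
by rewrite (bigD1 j) //= (le_trans (ler_norm _)) // lerDl sumr_ge0.
Qed.

Lemma min_over_fin_le (R : realType) (I : finType) (f : I -> R) i :
  min_over [set: I] f <= f i.
Proof.
apply: min_over_le => //; exists (- \sum_j `|f j|) => _ [j _ <-].
rewrite lerNl (bigD1 j) //= (le_trans (ler_norm _)) // normrN lerDl.
exact: sumr_ge0.
Qed.

Lemma compact_bounds (R : realType) (T : topologicalType) (X : set T)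
    (f : T -> R) :
  compact X -> continuous f ->
  has_ubound [set f x | x in X] /\ has_lbound [set f x | x in X].
Proof.
move=> cX cf; have cfX : compact (f @` X).
  by apply: continuous_compact => //; exact: continuous_subspaceT.
have [M [_ bM]] := compact_bounded cfX.
split; [exists (M + 1)|exists (- (M + 1))] => y /bM yM.
  by rewrite (le_trans (ler_norm _)) // yM // ltrDl.
by rewrite lerNl (le_trans (ler_norm _)) // normrN yM // ltrDl.
Qed.

Lemma entry_le_mx_norm (R : realType) m n (M : 'M[R]_(m, n)) i j :
  `|M i j| <= `|M|.
Proof.
rewrite [leRHS]/Num.norm /= mx_normrE.
exact: (le_bigmax _ (fun ij => `|M ij.1 ij.2|) (i, j)).
Qed.

Section CostLemmas.
Variables (R : realType) (n : nat) (c : 'cV[R]_n).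

Lemma costD x y : cost c (x + y) = cost c x + cost c y.
Proof. by rewrite /cost mulmxDr mxE. Qed.

Lemma costZ t x : cost c (t *: x) = t * cost c x.
Proof. by rewrite /cost -scalemxAr mxE. Qed.

Lemma cost_continuous : continuous (cost c).
Proof. exact: continuous_mulmx_entry. Qed.

End CostLemmas.

(** * A single agent *)

Section AgentLemmas.
Variables (R : realType) (S n : nat).
Variables (X : set 'cV[R]_n) (c : 'cV[R]_n) (A : 'M[R]_(S, n)).
Hypothesis cX : compact X.

Lemma cost_le_max z : conv_hull X z -> cost c z <= max_over X (cost c).
Proof.
apply: conv_hull_mulmx_le => x Xx; apply: (max_over_ge (f := cost c)) => //.
by have [] := compact_bounds cX (@cost_continuous R n c).
Qed.

Lemma cost_ge_min z : conv_hull X z -> min_over X (cost c) <= cost c z.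
Proof.
move=> Xz; rewrite -lerN2 -[- cost c z]mulN1r -costZ.
have -> : cost c (-1 *: z) = ((- c)^T *m z) 0 0.
  by rewrite costZ mulN1r /cost linearN /= mulNmx [RHS]mxE.
apply: conv_hull_mulmx_le Xz => x Xx; rewrite linearN /= mulNmx [leLHS]mxE lerN2.
apply: (min_over_le (f := cost c)) => //.
by have [] := compact_bounds cX (@cost_continuous R n c).
Qed.

Lemma cost_diff_le x z : conv_hull X x -> conv_hull X z ->
  cost c x - cost c z <= cost_range X c.
Proof. by move=> Xx Xz; apply: lerB; [exact: cost_le_max|exact: cost_ge_min]. Qed.

Lemma agent_feasible_compact y : compact (agent_feasible X A y).
Proof.
rewrite (_ : agent_feasible X A y = (\bigcap_(s in [set: 'I_S])
   (fun x => (A *m x) s 0) @^-1` [set t | t <= y s 0]) `&` conv_hull X).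
  rewrite setIC; apply: compact_closedI; first exact: conv_hull_compact.
  apply: closed_bigI => s _; apply: preimage_closed => [x _|].
    exact: continuous_mulmx_entry.
  exact: closed_le.
by apply/seteqP; split => x /= [xi Xx]; split => // s; [move=> _|]; exact: xi.
Qed.

Lemma agent_value_attained y : agent_domain X A y ->
  exists z, minimizer (agent_feasible X A y) (cost c) z.
Proof.
move=> y0; have [|z zF zmin] := compact_EVT_min (f := cost c) y0
    (@agent_feasible_compact y).
  exact/continuous_subspaceT/cost_continuous.
exists z; split; first by rewrite inE in zF.
by move=> x Fx; apply: zmin; rewrite inE.
Qed.

Lemma agent_value_le y z : agent_feasible X A y z ->
  agent_value X c A y <= cost c z.
Proof.
move=> Fz; apply: min_over_le => //.
by have [] := compact_bounds (@agent_feasible_compact y)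
  (@cost_continuous R n c).
Qed.

(** Such a [z] is feasible with violation zero, so the optimal violation is zero
as well and [z] competes on cost. *)
Lemma lex_cost_le y rho xi x z : lex_optimal X c A y rho xi x ->
  X z -> vle (A *m z) y -> cost c x <= cost c z.
Proof.
move=> [[cx Ax Xx rho0] opt] Xz Az.
have [|r0|[_ xi_le]] := opt 0 (cost c z) z.
- by split => // s; rewrite [leRHS]mxE [X in _ <= _ + X]mxE addr0.
- by move: (le_lt_trans rho0 r0); rewrite ltxx.
- exact: le_trans xi_le.
Qed.

(** The direction points to a generator [v j] of positive weight. In
[z + t *: (v j - z)] the generators have weights [(1 - t) * w i], plus [t] on
[j]; these stay nonnegative for |t| up to [w j]. *)
Lemma conv_hull_direction z : conv_hull X z -> ~ X z ->
  exists d e, [/\ d != 0, 0 < e &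
    forall t, `|t| <= e -> conv_hull X (z + t *: d)].
Proof.
move=> [k [w [v [w_ge0 w_sum Xv zE]]]] XNz.
have [j wj] : exists j, 0 < w j.
  apply: contrapT => /forallNP w0.
  have := oner_neq0 R; rewrite -w_sum big1 ?eqxx // => j _.
  by apply/eqP; rewrite eq_le w_ge0 leNgt andbT; exact/negP/w0.
have wj1 : w j <= 1 by rewrite -w_sum (bigD1 j) //= lerDl sumr_ge0.
exists (v j - z), (w j); split => //.
  by rewrite subr_eq0; apply: contra_notN XNz => /eqP <-.
move=> t; rewrite ler_norml => /andP[wt tw].
exists k, (fun i => (1 - t) * w i + t * (i == j)%:R), v; split => //.
- move=> i; case: (eqVneq i j) => [->|_]; last first.
    by rewrite mulr0 addr0 mulr_ge0 // subr_ge0 (le_trans tw).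
  by rewrite mulr1; nra.
- rewrite big_split /= -!mulr_sumr w_sum mulr1 (bigD1 j) //= eqxx big1 => [|i].
    by rewrite addr0 mulr1 subrK.
  by move/negPf->.
- under eq_bigr do rewrite scalerDl -!scalerA.
  rewrite big_split /= -!scaler_sumr -zE (bigD1 j) //= eqxx scale1r.
  rewrite big1 => [|i /negPf->]; last by rewrite scale0r.
  by rewrite addr0 scalerBr scalerBl scale1r addrA addrAC.
Qed.

End AgentLemmas.

(** * The coupled problems *)

Section CoupledLemmas.
Variables (R : realType) (N S : nat) (n : 'I_N -> nat).
Variables (X : forall i, set 'cV[R]_(n i)) (c : forall i, 'cV[R]_(n i)).
Variables (A : forall i, 'M[R]_(S, n i)) (b : 'cV[R]_S).
Arguments X : clear implicits.

(** A unique optimal solution behaves like a vertex. The fractional agents have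
two-sided directions [d i] in their hulls; with more than [S] of them some
nonzero combination of the [A i *m d i] vanishes. Moving along it both ways
preserves feasibility, so the cost is constant along it and a second optimal
solution appears. *)
Lemma lp_unique_integral (sigma : 'cV[R]_S) (z : forall i, 'cV[R]_(n i)) :
  (exists! z', lp_optimal X c A b sigma z') -> lp_optimal X c A b sigma z ->
  (#|finset (fun i => ~~ `[< X i (z i) >])| <= S)%N.
Proof.
move=> [z0 [_ z_uniq]] z_opt; rewrite leqNgt; apply/negP.
set D := finset _ => ltSD; have [[Az Xz] z_min] := z_opt.
have deP i : exists de : 'cV[R]_(n i) * R,
    [/\ i \in D -> de.1 != 0, 0 < de.2 &
        i \in D -> forall t, `|t| <= de.2 -> conv_hull (X i) (z i + t *: de.1)].
  have [iD|iD] := boolP (i \in D); last by exists (0, 1).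
  have [|d [e [d0 e0 dP]]] := conv_hull_direction (Xz i).
    by move: iD; rewrite inE => /asboolPn.
  by exists (d, e).
pose d i := (projT1 (cid (deP i))).1; pose e i := (projT1 (cid (deP i))).2.
have d_neq0 i : i \in D -> d i != 0 by rewrite /d; case: cid => ? [].
have e_gt0 i : 0 < e i by rewrite /e; case: cid => ? [].
have dP i t : i \in D -> `|t| <= e i -> conv_hull (X i) (z i + t *: d i).
  by rewrite /d /e; case: cid => ? [_ _ /= h] /h; exact.
have [l [[i1 li1] l0 l_dep]] := linear_dependence (fun i => A i *m d i) ltSD.
have i1D : i1 \in D by apply: contraNT li1 => /l0 ->.
(* Small enough for [eps * |l i| <= e i] to hold for all agents at once. *)
pose eps := (1 + \sum_i `|l i| / e i)^-1.
have sum_ge0 : 0 <= \sum_i `|l i| / e i.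
  by apply: sumr_ge0 => i _; rewrite divr_ge0 // ltW.
have eps_gt0 : 0 < eps by rewrite invr_gt0 ltr_pwDl.
have eps_le i : eps * `|l i| <= e i.
  rewrite mulrC ler_pdivrMr ?ltr_pwDl // mulrC -ler_pdivrMr //.
  rewrite (bigD1 i) //= addrCA lerDl addr_ge0 // sumr_ge0 // => j _.
  by rewrite divr_ge0 // ltW.
pose zt t i := z i + (t * l i) *: d i.
have zt_feas t : `|t| <= eps -> lp_feasible X A b sigma (zt t).
  move=> t_le; split.
    suff -> : \sum_i A i *m zt t i = \sum_i A i *m z i by [].
    under eq_bigr do rewrite mulmxDr -scalemxAr -scalerA.
    by rewrite big_split /= -scaler_sumr l_dep scaler0 addr0.
  move=> i; rewrite /zt; have [iD|iD] := boolP (i \in D).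
    apply: dP => //; rewrite normrM (le_trans _ (eps_le i)) //.
    by rewrite ler_wpM2r.
  by rewrite l0 // mulr0 scale0r addr0; exact: Xz.
pose K := \sum_i l i * cost (c i) (d i).
have zt_cost t : total_cost c (zt t) = total_cost c z + t * K.
  rewrite /total_cost /K mulr_sumr -big_split; apply: eq_bigr => i _ /=.
  by rewrite costD costZ mulrA.
have eps_norm : `|eps| <= eps by rewrite ger0_norm // ltW.
have K0 : K = 0.
  have /z_min := zt_feas _ eps_norm.
  rewrite zt_cost lerDl pmulr_rge0 // => K_ge0.
  have /z_min : lp_feasible X A b sigma (zt (- eps)).
    by apply: zt_feas; rewrite normrN.
  rewrite zt_cost lerDl mulNr oppr_ge0 pmulr_rle0 // => K_le0.
  by apply/eqP; rewrite eq_le K_le0.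
have zt_opt : lp_optimal X c A b sigma (zt eps).
  by split; [exact: zt_feas|rewrite zt_cost K0 mulr0 addr0].
have /(congr1 (fun f => f i1)) : z = zt eps.
  by rewrite -(z_uniq _ z_opt) -(z_uniq _ zt_opt).
move=> /eqP; rewrite /zt -subr_eq0 opprD addrA subrr add0r oppr_eq0.
by rewrite scaler_eq0 mulf_eq0 gt_eqF // (negPf li1) (negPf (d_neq0 _ i1D)).
Qed.

Hypothesis cX : forall i, compact (X i).

(** The convex combination of [x] and [zhat] with weight
[t = |sigma| / (|sigma| + zeta)] on [zhat] uses at most
[b - t *: (sigma + zeta)], and [t * (sigma s + zeta) >= sigma s] because
[sigma s <= |sigma|]. *)
Lemma lp_slater_cost (sigma : 'cV[R]_S) (x zhat z : forall i, 'cV[R]_(n i))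
    (zeta G : R) : (0 < N)%N ->
  (forall i, cost_range (X i) (c i) <= G) ->
  milp_feasible X A b x -> (forall i, conv_hull (X i) (zhat i)) ->
  0 < zeta -> (forall s, zeta <= (b - sigma - \sum_i A i *m zhat i) s 0) ->
  lp_optimal X c A b sigma z ->
  total_cost c z <= total_cost c x + N%:R * `|sigma| / zeta * G.
Proof.
move=> N0 rangeG [Ax Xx] Xzhat zeta0 slater [_ z_min].
have convx i : conv_hull (X i) (x i) by exact: subset_conv_hull.
have G0 : 0 <= G.
  apply: le_trans (rangeG (Ordinal N0)).
  have := cost_diff_le (c (Ordinal N0)) (@cX _) (convx _) (convx _).
  by rewrite subrr.
pose t := `|sigma| / (`|sigma| + zeta).
have den0 : 0 < `|sigma| + zeta by rewrite ltr_wpDl.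
have t0 : 0 <= t by rewrite divr_ge0 // ltW.
have t1 : t <= 1 by rewrite ler_pdivrMr // mul1r lerDl ltW.
have tE : t * zeta = (1 - t) * `|sigma|.
  by rewrite /t; field; rewrite gt_eqF.
pose z' i := (1 - t) *: x i + t *: zhat i.
have z'_feas : lp_feasible X A b sigma z'.
  split; last by move=> i; apply: conv_hull_convex => //; rewrite t0.
  move=> s.
  have -> : \sum_i A i *m z' i =
      (1 - t) *: (\sum_i A i *m x i) + t *: (\sum_i A i *m zhat i).
    rewrite !scaler_sumr -big_split; apply: eq_bigr => i _ /=.
    by rewrite mulmxDr !scalemxAr.
  have := slater s; have := Ax s.
  move: (\sum_i A i *m x i) (\sum_i A i *m zhat i) => u v.
  have := le_trans (ler_norm _) (entry_le_mx_norm sigma s 0).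
  rewrite !mxE; nra.
apply: le_trans (z_min _ z'_feas) _.
have -> : total_cost c x + N%:R * `|sigma| / zeta * G =
    \sum_i (cost (c i) (x i) + `|sigma| / zeta * G).
  by rewrite big_split /= sumr_const card_ord -[X in _ = _ + X]mulr_natl !mulrA.
apply: ler_sum => i _; rewrite costD !costZ.
have dG := le_trans (cost_diff_le (c i) (@cX i) (Xzhat i) (convx i)) (rangeG i).
have : t * (cost (c i) (zhat i) - cost (c i) (x i)) <= `|sigma| / zeta * G.
  apply: le_trans (ler_wpM2l t0 dG) _; apply: ler_wpM2r => //.
  apply: ler_wpM2l => //; rewrite lef_pV2 ?posrE //.
  by rewrite lerDr.
lra.
Qed.

Lemma master_lp_optimal (sigma : 'cV[R]_S) (y : 'I_N -> 'cV[R]_S) :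
  (0 < N)%N -> master_optimal X c A b sigma y ->
  exists2 z, lp_optimal X c A b sigma z & forall i, vle (A i *m z i) (y i).
Proof.
move=> N0 [[y_sum y_dom] y_min].
have attained i := agent_value_attained (c i) (@cX i) (y_dom i).
pose z i := projT1 (cid (attained i)).
have zP i : minimizer (agent_feasible (X i) (A i) (y i)) (cost (c i)) (z i).
  by rewrite /z; case: cid.
have Az i : vle (A i *m z i) (y i) by have [[]] := zP i.
exists z => //; split.
  split; last by move=> i; have [[]] := zP i.
  by move=> s; rewrite -y_sum !summxE; apply: ler_sum => i _; exact: Az.
move=> z' [Az' Xz'].
have -> : total_cost c z = master_cost X c A y.
  by apply: eq_bigr => i _; rewrite /agent_value (min_over_minimizer (zP i)).
have i0 : 'I_N := Ordinal N0.
pose r := b - sigma - \sum_i A i *m z' i.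
have r_ge0 s : 0 <= r s 0 by rewrite mxE [X in _ + X]mxE subr_ge0.
(* The usage of [z'], with the whole slack [r] given to agent [i0]. *)
pose y' i := A i *m z' i + (i == i0)%:R *: r.
have y'_feas i : agent_feasible (X i) (A i) (y' i) (z' i).
  split=> // s; rewrite [leRHS]mxE lerDl mxE mulr_ge0 //.
apply: (@le_trans _ _ (master_cost X c A y')).
  apply: y_min; split; last by move=> i; exists (z' i).
  rewrite big_split /=.
  have -> : \sum_i (i == i0)%:R *: r = r.
    rewrite (bigD1 i0) //= eqxx scale1r big1 ?addr0 // => i /negPf->.
    by rewrite scale0r.
  by rewrite addrC subrK.
by apply: ler_sum => i _; exact: agent_value_le.
Qed.

End CoupledLemmas.

Theorem mainTheorem3 (R : realType) (N S : nat) (hN : (0 < N)%N) (hS : (0 < S)%N)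
  (p q : 'I_N -> nat)
  (P X : forall i : 'I_N, set 'cV[R]_(p i + q i))
  (c : forall i : 'I_N, 'cV[R]_(p i + q i))
  (A : forall i : 'I_N, 'M[R]_(S, p i + q i))
  (b : 'cV[R]_S)
  (P_polyhedron : forall i, polyhedron (P i))
  (P_compact : forall i, compact (P i))
  (P_nonempty : forall i, P i !=set0)
  (X_def : forall i, X i = P i `&` mixed_integer R (p i) (q i))
  (milp_feas : milp_feasible X A b !=set0)
  (sigma : 'cV[R]_S) (sigma_def : sigma = sigma_infty X A)
  (lp_feas : lp_feasible X A b sigma !=set0)
  (lp_unique : exists! z, lp_optimal X c A b sigma z)
  (sigma_gt0 : forall s, 0 < sigma s 0)
  (zhat : forall i : 'I_N, 'cV[R]_(p i + q i))
  (zhat_conv : forall i, conv_hull (X i) (zhat i))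
  (zeta : R) (zeta_def : zeta = slater_margin A b sigma zhat)
  (zeta_gt0 : 0 < zeta)
  (ystar : 'I_N -> 'cV[R]_S)
  (ystar_opt : master_optimal X c A b sigma ystar)
  (rho xi : 'I_N -> R)
  (xinf : forall i : 'I_N, 'cV[R]_(p i + q i))
  (xinf_opt : forall i,
    lex_optimal (X i) (c i) (A i) (ystar i) (rho i) (xi i) (xinf i)) :
  total_cost c xinf - milp_value X c A b
    <= (S%:R + N%:R * `|sigma| / zeta) * max_cost_range X c.
Proof.
have cX i : compact (X i).
  by rewrite X_def; apply: compact_closedI => //; exact: mixed_integer_closed.
set G := max_cost_range X c.
have rangeG i : cost_range (X i) (c i) <= G.
  exact: (max_over_fin_ge (fun i => cost_range (X i) (c i))).
have slater s : zeta <= (b - sigma - \sum_i A i *m zhat i) s 0.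
  by rewrite zeta_def; exact: min_over_fin_le.
have xinfX i : conv_hull (X i) (xinf i).
  by apply: subset_conv_hull; have [[]] := xinf_opt i.
have [z z_opt Az] := master_lp_optimal cX hN ystar_opt.
have Xz i : conv_hull (X i) (z i) by case: z_opt => [[_ convz] _]; exact: convz.
have G_ge0 : 0 <= G.
  apply: le_trans (rangeG (Ordinal hN)).
  have := cost_diff_le (c _) (cX _) (xinfX _) (xinfX (Ordinal hN)).
  by rewrite subrr.
have xinf_z : total_cost c xinf <= total_cost c z + S%:R * G.
  pose D := finset (fun i => ~~ `[< X i (z i) >]).
  have leDS : (#|D| <= S)%N by exact: lp_unique_integral lp_unique z_opt.
  apply: (@le_trans _ _ (total_cost c z + \sum_(i in D) G)); last first.
    by rewrite lerD2l sumr_const -[leLHS]mulr_natl ler_wpM2r // ler_nat.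
  rewrite big_mkcond -big_split; apply: ler_sum => i _ /=.
  rewrite inE; case: asboolP => /= Xzi.
    by rewrite addr0; apply: lex_cost_le (xinf_opt i) Xzi (Az i).
  by rewrite -lerBlDl (le_trans _ (rangeG i)) // cost_diff_le.
suff : total_cost c xinf - (S%:R + N%:R * `|sigma| / zeta) * G
    <= milp_value X c A b.
  by rewrite lerBlDr lerBlDl.
apply: lb_le_inf; first by case: milp_feas => x Fx; exists (total_cost c x), x.
move=> _ [x Fx <-].
have z_x := lp_slater_cost cX hN rangeG Fx zhat_conv zeta_gt0 slater z_opt.
rewrite lerBlDl mulrDl; apply: le_trans xinf_z _.
lra.
Qed.
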